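(* Let $G$ be a clique tree in $\mathcal{CT}$. The $\mathcal E$-spectrum of $G$ is symmetric with respect to the origin if and only if $G$ has odd diameter and exactly two central vertices, which are adjacent (i.e. $\mathrm{diam}(G)$ is odd and $C(G)$ consists of exactly two adjacent vertices).
   Context: Graphs are finite, simple and undirected, with at least two vertices. A cut-vertex of a connected graph $G$ is a vertex whose removal disconnects $G$; a block of $G$ is a maximal connected subgraph $B$ having no cut-vertices of its own (no cut-vertex of $B$). A clique tree is a connected graph whose blocks are all complete graphs. $\mathcal{CT}$ is the class of clique trees $G$ such that each block of $G$ contains at most two cut-vertices of $G$. For a connected graph $G$, $d_G(u,v)$ is the distance and $e_G(u)=\max\{d_G(u,v)\mid v\in V_G\}$ the eccentricity of $u$. The center $C(G)$ is the set of vertices (central vertices) of minimum eccentricity. The eccentricity matrix $\mathcal E(G)=(\epsilon_{uv})$, indexed by $V_G\times V_G$, has $\epsilon_{uv}=d_G(u,v)$ if $d_G(u,v)=\min\{e_G(u),e_G(v)\}$ and $\epsilon_{uv}=0$ otherwise. The $\mathcal E$-spectrum of $G$ is the multiset of eigenvalues of $\mathcal E(G)$; it is symmetric with respect to the origin if for every real $\lambda$ the multiplicities of $\lambda$ and $-\lambda$ as eigenvalues of $\mathcal E(G)$ are equal. *)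

(* Defs.v *)
From mathcomp Require Import all_boot all_order all_algebra reals.

Set Implicit Arguments.
Unset Strict Implicit.
Unset Printing Implicit Defensive.

Import GRing.Theory Num.Theory.

Record sgraph := SGraph {
  vertex :> finType;
  adj : rel vertex;
  adj_sym : symmetric adj;
  adj_irr : irreflexive adj
}.

Section Connectivity.
Variable G : sgraph.
Implicit Types (S : {set G}) (F : rel G).

(* A subgraph is given by a vertex set S and an edge relation F; it need not
   be induced. *)
Definition subgraph S F : Prop :=
  symmetric F /\ forall x y, F x y -> [/\ x \in S, y \in S & adj x y].

(* Paths are confined to S, so that deleting v amounts to replacing S by
   S :\ v. The empty graph counts as connected. *)
Definition connected S F : bool :=
  [forall x in S, forall y in S,
    connect [rel a b | [&& a \in S, b \in S & F a b]] x y].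

Definition cut_vertex S F (v : G) : bool :=
  (v \in S) && ~~ connected (S :\ v) F.

Definition nonseparable S F : Prop :=
  [/\ subgraph S F, connected S F & forall v, ~~ cut_vertex S F v].

Definition block S F : Prop :=
  nonseparable S F /\
  forall S' F', nonseparable S' F' -> S \subset S' -> subrel F F' ->
    S' = S /\ F' =2 F.

Definition complete S F : Prop :=
  {in S &, forall x y, x != y -> F x y}.

Definition graph_connected : bool := connected [set: G] (@adj G).

Definition cut_vertices : {set G} := [set v | cut_vertex [set: G] (@adj G) v].

Definition clique_tree : Prop :=
  graph_connected /\ forall S F, block S F -> complete S F.

Definition in_CT : Prop :=
  clique_tree /\ forall S F, block S F -> #|S :&: cut_vertices| <= 2.

End Connectivity.

Section Distance.
Variable G : sgraph.
Implicit Types u v : G.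

Definition walk_of_length n u v : bool :=
  [exists p : n.-tuple G, path (@adj G) u p && (last u p == v)].

(* Vertices joined by a walk are joined by one of length less than #|G|;
   the value is #|G| if v is not reachable from u. *)
Definition dist u v : nat :=
  find (fun n => walk_of_length n u v) (iota 0 #|G|).

Definition ecc u : nat := \max_(v : G) dist u v.

Definition diam : nat := \max_(u : G) ecc u.

Definition center : {set G} := [set u | [forall v, ecc u <= ecc v]].

End Distance.

Local Open Scope ring_scope.

Definition ecc_matrix (R : nzRingType) (G : sgraph) : 'M[R]_#|G| :=
  \matrix_(i, j)
    let u := enum_val i in let v := enum_val j in
    if dist u v == minn (ecc u) (ecc v) then (dist u v)%:R else 0.

Definition spectrum_symmetric (R : realType) (n : nat) (A : 'M[R]_n) : Prop :=
  forall x : R, mup x (char_poly A) = mup (- x) (char_poly A).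

(* Main.v *)
Require Import Defs.
From mathcomp Require Import all_boot all_order all_algebra reals.
From mathcomp Require Import complex zify.

(** Every cycle of [G] lies in a block, so its vertices are pairwise adjacent;
    this makes the predecessor of a vertex towards another one unique, and
    yields the four-point condition
    [d(a,b) + d(c,d) <= max (d(a,c) + d(b,d)) (d(a,d) + d(b,c))].
    Consequently [e(w) = max (d(w,x)) (d(w,y))] for any diametral pair [x], [y].

    If the spectrum is symmetric, the nonnegative matrix [E] has
    [tr (E ^ 3) = 0], so no three of its entries form a triangle.  In even
    diameter [x], [y] and the midpoint of a geodesic between them form such a
    triangle; in odd diameter, so do [x], [y] and any central vertex other than
    the ends of the middle edge.

    Conversely, when the middle edge [uv] is the whole center, no vertex is
    equidistant from [u] and [v], and two vertices on the same side of [uv] are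
    closer than both their eccentricities.  Hence [E] is bipartite, and
    conjugating it by the diagonal matrix of signs gives [- E]. *)

Set Implicit Arguments.
Unset Strict Implicit.
Unset Printing Implicit Defensive.

Import GRing.Theory Num.Theory.

(** * Spectra of symmetric matrices *)

Section Spectrum.
Local Open Scope ring_scope.

Lemma char_poly_conj (F : fieldType) n (P A : 'M[F]_n) :
  P \in unitmx -> char_poly (invmx P *m A *m P) = char_poly A.
Proof.
move=> uP; pose Q := map_mx polyC P.
have uQ : Q \in unitmx by rewrite unitmxE det_map_mx rmorph_unit // -unitmxE.
rewrite /char_poly; have -> : char_poly_mx (invmx P *m A *m P) =
   map_mx polyC (invmx P) *m char_poly_mx A *m Q.
  rewrite /char_poly_mx mulmxBr mulmxBl -!map_mxM; congr (_ - _).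
  by rewrite mul_mx_scalar -scalemxAl -map_mxM mulVmx // map_mx1 scalemx1.
rewrite !det_mulmx mulrAC -det_mulmx -map_mxM mulVmx //.
by rewrite map_mx1 det1 mul1r.
Qed.

Lemma char_poly_diag (F : fieldType) n (d : 'rV[F]_n) :
  char_poly (diag_mx d) = \prod_(i < n) ('X - (d 0 i)%:P).
Proof.
rewrite char_poly_trig ?diag_mx_is_trig //.
by apply: eq_bigr => i _; rewrite !mxE eqxx mulr1n.
Qed.

(** Over [R[i]] the matrix is Hermitian, so the spectral theorem diagonalizes it with real entries.
    Both identities then descend along the injective embedding of [R]. *)
Lemma symmetric_char_poly (R : rcfType) n (A : 'M[R]_n) : A^T = A ->
  exists d : 'I_n -> R, char_poly A = \prod_i ('X - (d i)%:P) /\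
    \tr (A *m A *m A) = \sum_i d i ^+ 3.
Proof.
move=> symA; pose f := real_complex R; pose B := map_mx f A.
have hB : B \is hermsymmx.
  apply/is_hermitianmxP; rewrite expr0 scale1r; apply/matrixP => i j.
  rewrite !mxE -[in LHS]symA mxE; apply/esym/CrealP.
  by apply/complex_realP; exists (A j i).
set P := spectralmx B; set D := spectral_diag B.
have uP : P \in unitmx by apply: spectral_unit.
have BE : B = invmx P *m diag_mx D *m P.
  exact/orthomx_spectralP/hermitian_normalmx.
have DE i : f (complex.Re (D 0 i)) = D 0 i.
  apply: RRe_real; exact: (mxOverP (hermitian_spectral_diag_real hB)).
exists (fun i => complex.Re (D 0 i)); split.
  apply: (map_poly_inj f); rewrite map_char_poly -/B BE char_poly_conj //.
  rewrite char_poly_diag rmorph_prod; apply: eq_bigr => i _.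
  by rewrite rmorphB /= map_polyX map_polyC; congr (_ - _%:P).
apply: (fmorph_inj f); rewrite -trace_map_mx !map_mxM -/B rmorph_sum /=.
have -> : B *m B *m B = invmx P *m (diag_mx D *m diag_mx D *m diag_mx D) *m P.
  by rewrite BE !mulmxA !mulmxK.
rewrite mxtrace_mulC mulKVmx // !mulmx_diag mxtrace_diag.
apply: eq_bigr => i _.
by rewrite rmorphXn !mxE !exprS expr0 mulr1 mulrA -{1 2 3}(DE i).
Qed.

(** The sum of the cubes of the eigenvalues equals its own opposite. *)
Lemma symmetric_spectrum_trace_cube (R : rcfType) n (A : 'M[R]_n) :
    A^T = A ->
    (forall x, mup x (char_poly A) = mup (- x) (char_poly A)) ->
  \tr (A *m A *m A) = 0.
Proof.
move=> /symmetric_char_poly [d [cA tA]] symm.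
pose s := [seq d i | i <- enum 'I_n].
have cs : char_poly A = \prod_(y <- s) ('X - y%:P).
  by rewrite cA big_map big_enum.
(* Occurrences in [s] are root multiplicities, so the symmetry of the spectrum says that negation
   permutes [s]. *)
have ps : perm_eq s (map -%R s).
  apply/allP => x _ /=; apply/eqP.
  rewrite -mu_prod_XsubC -cs symm cs mu_prod_XsubC count_map.
  by apply: eq_count => y /=; rewrite eqr_oppLR.
have ts : \tr (A *m A *m A) = \sum_(y <- s) y ^+ 3.
  by rewrite tA big_map big_enum.
apply/eqP; rewrite -eqNr {2}ts (perm_big _ ps) big_map ts -sumrN.
by apply/eqP/eq_bigr => y _; rewrite !exprS expr0 !mulr1 mulrNN mulNr.
Qed.

(** The trace is the sum of these products over all closed walks of length 3, and each term is
    nonnegative. *)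
Lemma trace_cube_eq0 (R : numDomainType) n (A : 'M[R]_n) :
    (forall i j, 0 <= A i j) -> \tr (A *m A *m A) = 0 ->
  forall i j k, A i j * A j k * A k i = 0.
Proof.
move=> A_ge0 tr0 i j k.
have tE : \tr (A *m A *m A) = \sum_i \sum_k \sum_j A i j * A j k * A k i.
  apply: eq_bigr => a _; rewrite mxE; apply: eq_bigr => b _.
  by rewrite mxE mulr_suml.
move: tr0; rewrite tE.
have A3_ge0 a b c : 0 <= A a b * A b c * A c a by rewrite !mulr_ge0.
move=> /psumr_eq0P-/(_ _ i isT) tri.
have /psumr_eq0P-/(_ _ k isT) trik := tri (fun a _ =>
  sumr_ge0 _ (fun b _ => sumr_ge0 _ (fun c _ => A3_ge0 a c b))).
have /psumr_eq0P-/(_ _ j isT) := trik (fun b _ =>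
  sumr_ge0 _ (fun c _ => A3_ge0 i c b)).
by apply=> c _; apply: A3_ge0.
Qed.

Lemma bipartite_spectrum_symmetric (F : fieldType) n (A : 'M[F]_n)
    (side : pred 'I_n) :
    (forall i j, side i = side j -> A i j = 0) ->
  forall x, mup x (char_poly A) = mup (- x) (char_poly A).
Proof.
move=> A0 x.
pose S : 'M[F]_n := diag_mx (\row_i (-1) ^+ (side i)).
have SS : S *m S = 1%:M.
  rewrite mulmx_diag -diag_const_mx; congr diag_mx; apply/rowP => i.
  by rewrite !mxE -expr2 sqrr_sign.
have [uS _] := mulmx1_unit SS.
have SV : invmx S = S by rewrite -[RHS]mul1mx -(mulVmx uS) -mulmxA SS mulmx1.
have cN : char_poly A = char_poly (- A).
  rewrite -(char_poly_conj (- A) uS) SV; congr char_poly.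
  apply/matrixP => i j; rewrite /S mul_mx_diag mul_diag_mx !mxE.
  have [/A0->|] := eqVneq (side i) (side j); first by rewrite oppr0 mulr0 mul0r.
  case: (side i); case: (side j) => // _; rewrite expr0 expr1.
    by rewrite mulr1 mulN1r opprK.
  by rewrite mul1r mulrN1 opprK.
have cE : char_poly (- A) = (-1) ^+ n *: (char_poly A \Po (- 'X)).
  rewrite /char_poly -det_map_mx.
  rewrite -mul_polyC rmorphXn rmorphN rmorph1 -detZ; congr (\det _).
  apply/matrixP => i j; rewrite !mxE /=.
  rewrite rmorphB /= rmorphMn /= comp_polyX comp_polyC.
  by rewrite !mulN1r opprB polyCN opprK mulNrn opprK addrC.
(* The substitution turns the factor of [p] at [- x] into a power of ['X - x%:P] up to sign, and the
   cofactor stays nonzero at [x]. *)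
have mupN p : p != 0 -> mup x (p \Po (- 'X)) = mup (- x) p.
  move=> p0; have [m [q]] := multiplicity_XsubC p (- x).
  rewrite p0 /= => rq ->; rewrite comp_polyM !mupMr //; last first.
    by rewrite /root horner_comp hornerN hornerX.
  have -> : ('X - (- x)%:P) ^+ m \Po (- 'X) = ((-1) ^+ m)%:P * ('X - x%:P) ^+ m.
    rewrite rmorphXn rmorphB /= comp_polyX comp_polyC rmorphXn -exprMn.
    by congr (_ ^+ _); rewrite rmorphN1 polyCN mulN1r opprB opprK addrC.
  by rewrite mupMr ?mup_XsubCX ?eqxx // rootC signr_eq0.
rewrite {1}cN cE -mul_polyC mupMr ?rootC ?signr_eq0 // mupN //.
exact/monic_neq0/char_poly_monic.
Qed.
End Spectrum.

(** * Nonseparable sets of vertices *)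

Section Blocks.
Variable G : sgraph.
Implicit Types (S : {set G}) (u v w x y z : G).

(** Membership is built in so that this is an edge relation in the sense of [subgraph]; it is also
    the relation whose paths [connected S (@adj G)] examines. *)
Definition induced S : rel G := [rel a b | [&& a \in S, b \in S & adj a b]].

Lemma induced_sym S : symmetric (induced S).
Proof. by move=> a b; rewrite /induced /= andbCA adj_sym. Qed.

Lemma connect_induced_sym S : connect_sym (induced S).
Proof. exact/sym_connect_sym/induced_sym. Qed.

Lemma connected_hub S r :
  (forall x, x \in S -> connect (induced S) x r) -> connected S (@adj G).
Proof.
move=> toR; apply/forall_inP => x xS; apply/forall_inP => y yS.
by apply: connect_trans (toR x xS) _; rewrite connect_induced_sym toR.
Qed.

Lemma connected_subrel S (F F' : rel G) :
  (forall x y, x \in S -> y \in S -> F x y -> F' x y) ->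
  connected S F -> connected S F'.
Proof.
move=> sFF' /forall_inP conS.
apply/forall_inP => x xS; apply/forall_inP => y yS.
apply: connect_sub (forall_inP (conS x xS) y yS) => a b /and3P [aS bS Fab].
by apply: connect1; rewrite /= aS bS sFF'.
Qed.

(** A boolean condition on vertex sets alone, so that maximal sets exist by finiteness. *)
Definition nonseparable_set S :=
  connected S (@adj G) && [forall v in S, connected (S :\ v) (@adj G)].

Lemma nonseparable_induced S :
  nonseparable_set S -> nonseparable S (induced S).
Proof.
move=> /andP [conS /forall_inP cutS]; split.
- split; first exact: induced_sym.
  by move=> x y /and3P [].
- by apply: connected_subrel conS => x y xS yS xy; apply/and3P.
- move=> v; apply/negP => /andP [vS /negP]; apply.
  apply: connected_subrel (cutS v vS) => x y /setD1P [_ xS] /setD1P [_ yS] xy.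
  exact/and3P.
Qed.

Lemma nonseparable_setW S (F : rel G) : nonseparable S F -> nonseparable_set S.
Proof.
move=> [[_ sF] conS cutS].
have sFadj x y : F x y -> adj x y by move=> /sF [].
apply/andP; split.
  by apply: connected_subrel conS => x y _ _; apply: sFadj.
apply/forall_inP => v vS; have := cutS v; rewrite /cut_vertex vS negbK.
by apply: connected_subrel => x y _ _; apply: sFadj.
Qed.

(** A maximal nonseparable set containing [S], with all its induced edges, is a block, hence
    complete. *)
Lemma clique_tree_nonseparable S x y :
    clique_tree G -> nonseparable_set S -> x \in S -> y \in S -> x != y ->
  adj x y.
Proof.
move=> [_ blockK] nsS xS yS xy.
have [B /maxsetP [nsB maxB] sSB] := maxset_exists nsS.
have blockB : block B (induced B).
  split; first exact: nonseparable_induced.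
  move=> S' F' nsF' sBS' sBF'.
  have S'E := maxB _ (nonseparable_setW nsF') sBS'; split=> //.
  move=> a b; apply/idP/idP => [|/sBF' //].
  by case: nsF' => [[_ sF'] _ _] /sF'; rewrite S'E => [[? ? ?]]; apply/and3P.
have [xB yB] := (subsetP sSB x xS, subsetP sSB y yS).
by have /and3P [] := blockK _ _ blockB x y xB yB xy.
Qed.

Lemma path_connect_induced S x p :
  path (@adj G) x p -> {subset x :: p <= S} -> connect (induced S) x (last x p).
Proof.
move=> xp sS; apply/connectP; exists p => //.
elim: p x xp sS => //= y p IHp x /andP [xy yp] sS.
rewrite /induced /= xy !sS ?inE ?eqxx ?orbT //=; apply: IHp => // t tp.
by apply: sS; rewrite inE tp orbT.
Qed.

Definition avoiding u : rel G := [rel a b | [&& a != u, b != u & adj a b]].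

Lemma connect_avoiding_sym u : connect_sym (avoiding u).
Proof.
by apply: sym_connect_sym => a b; rewrite /avoiding /= andbCA adj_sym.
Qed.

(** The hypotheses describe a cycle through [u], or a single edge if [p] is empty. Deleting [u]
    leaves a path; deleting another vertex leaves at most two arcs, each attached to [u]. *)
Lemma cycle_nonseparable u z p :
    adj u z -> path (@adj G) z p -> uniq (z :: p) -> u \notin z :: p ->
    adj u (last z p) ->
  nonseparable_set (u |: [set x in z :: p]).
Proof.
move=> uz zp Up up uz'; set S := u |: _.
have uS : u \in S by rewrite setU11.
have pS x : x \in z :: p -> x \in S.
  by move=> xp; rewrite !inE in xp *; rewrite xp orbT.
have toz (T : {set G}) x :
  {subset z :: p <= T} -> x \in z :: p -> connect (induced T) x z.
  move=> sT xp; rewrite connect_induced_sym; move: xp zp sT.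
  move=> /splitPl {Up up uz' S uS pS}[p1 p2 <-].
  rewrite cat_path => /andP [zp1 _] sT.
  apply: path_connect_induced => // t tp.
  by apply: sT; rewrite -cat_cons mem_cat tp.
have zx := mem_head z p.
apply/andP; split.
  apply: (@connected_hub _ z) => x; rewrite !inE -in_cons => /orP [/eqP ->|].
    by apply: connect1; apply/and3P; rewrite uS pS.
  exact: toz.
apply/forall_inP => v; rewrite !inE -in_cons => /orP [/eqP ->|vp].
  apply: (@connected_hub _ z) => x; rewrite !inE -in_cons.
  move=> /andP [/negPf -> /=]; apply: toz => t tp.
  rewrite !inE -in_cons tp orbT andbT.
  by apply: contraNneq up => <-.
have uv : u != v by apply: contraNneq up => ->.
have vS x : x \in z :: p -> x != v -> x \in S :\ v.
  by move=> xp xv; rewrite in_setD1 xv pS.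
have uSv : u \in S :\ v by rewrite in_setD1 uv.
apply: (@connected_hub _ u) => x; rewrite !inE -in_cons => /andP [xv].
move=> /orP [/eqP -> //|xp].
(* Cutting the cycle at [v], the part of it on the side of [z] reaches [u]
   through [z], the other part through the last vertex of [p]. *)
clearbody S; move: vp zp Up uz' vS xp {up pS toz zx}.
case/splitPl => p1 p2 p1v; rewrite cat_path last_cat p1v -cat_cons cat_uniq.
move=> /andP [zp1 vp2] /and3P [Up1 p12 Up2] uz' vS.
rewrite mem_cat => /orP [xp1|xp2].
  case/splitPl: xp1 Up1 zp1 p1v vS => q1 q2 q1x.
  rewrite -cat_cons cat_uniq cat_path last_cat q1x => /and3P [_ q12 _].
  move=> /andP [zq1 _] q2v vS.
  have q1S t : t \in z :: q1 -> t \in S :\ v.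
    move=> tq1; apply: vS; first by rewrite !mem_cat tq1.
    apply: contraNneq q12 => tv; apply/hasP; exists t => //.
    have := mem_last x q2; rewrite q2v -tv inE => /predU1P [tx|//].
    by rewrite -tx tv eqxx in xv.
  have xz : connect (induced (S :\ v)) x z.
    by rewrite connect_induced_sym -q1x path_connect_induced.
  apply: connect_trans xz (connect1 _); apply/and3P.
  by rewrite uSv q1S ?mem_head // adj_sym.
case/splitPr: xp2 vp2 p12 Up2 uz' vS => q1 q2; rewrite cat_path last_cat /=.
move=> /and3P [_ _ xq2] p12 _ uz' vS.
have q2S t : t \in x :: q2 -> t \in S :\ v.
  move=> tq2; apply: vS; first by rewrite -cat_cons !mem_cat tq2 !orbT.
  apply: contraNneq p12 => tv; apply/hasP; exists t; last first.
    by rewrite tv -p1v mem_last.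
  by rewrite mem_cat tq2 orbT.
apply: connect_trans (path_connect_induced xq2 q2S) (connect1 _); apply/and3P.
by rewrite uSv q2S ?mem_last // adj_sym.
Qed.

(** A simple path from [z] to [z'] avoiding [u] closes up through [u] into a cycle. *)
Lemma clique_tree_neighbors u z z' :
    clique_tree G -> adj u z -> adj u z' -> z != z' ->
    connect (avoiding u) z z' ->
  adj z z'.
Proof.
move=> ctG uz uz' zz' /connectP [p0 zp0 z'E].
case/shortenP: zp0 z'E => p zp Up _ z'E.
have up : u \notin z :: p.
  rewrite inE negb_or; apply/andP; split.
    by apply: contraTneq uz => <-; rewrite adj_irr.
  elim: p z zp {Up z'E uz zz' p0} => //= y p IHp z /andP [/and3P [_ yu _] yp].
  by rewrite inE negb_or eq_sym yu (IHp y).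
have zp' : path (@adj G) z p by apply: sub_path zp => a b /and3P [].
rewrite {}z'E in uz' zz' *.
have ns := cycle_nonseparable uz zp' Up up uz'.
apply: clique_tree_nonseparable ctG ns _ _ zz'.
  by rewrite !inE eqxx orbT.
by rewrite !inE -in_cons mem_last orbT.
Qed.
End Blocks.

(** * Distances in clique trees *)

Section Distances.
Variable G : sgraph.
Implicit Types (a b c d u v w x y z : G).

Lemma dist_leq_size u p : path (@adj G) u p -> dist u (last u p) <= size p.
Proof.
move=> up; have [pG|Gp] := ltnP (size p) #|G|; last first.
  by apply: leq_trans Gp; rewrite -[leqRHS](size_iota 0) find_size.
rewrite leqNgt; apply/negP => /(before_find 0); rewrite nth_iota //= add0n.
move/existsP; apply; exists (in_tuple p); by rewrite up eqxx.
Qed.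

Lemma distxx u : dist u u = 0.
Proof. by apply/eqP; rewrite -leqn0 (@dist_leq_size u [::]). Qed.

Lemma adj_dist_leq1 u v : adj u v -> dist u v <= 1.
Proof. by move=> uv; apply: (@dist_leq_size u [:: v]); rewrite /= uv. Qed.

Hypothesis connG : graph_connected G.

Lemma dist_path u v :
  exists p, [/\ path (@adj G) u p, last u p = v & size p = dist u v].
Proof.
have uv : connect (@adj G) u v.
  have := forall_inP (forall_inP connG u (in_setT u)) v (in_setT v).
  by apply: connect_sub => a b /and3P [_ _ ab]; apply: connect1.
have /hasP [n] : has (fun n => walk_of_length n u v) (iota 0 #|G|).
  (* A walk without repetition has fewer than [#|G|] edges, which puts its length in the range
     searched by [dist]. *)
  have /connectP [q0 uq0 ->] := uv; have [q uq Uq _] := shortenP uq0.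
  apply/hasP; exists (size q).
    by have := max_card (mem (u :: q)); rewrite mem_iota (card_uniqP Uq).
  by apply/existsP; exists (in_tuple q); rewrite /= uq eqxx.
move=> nG walk_n.
have /(nth_find 0) : has (fun n => walk_of_length n u v) (iota 0 #|G|).
  by apply/hasP; exists n.
rewrite -/(dist u v) nth_iota ?add0n; last first.
  rewrite -[ltnRHS](size_iota 0) -has_find; apply/hasP; by exists n.
by move=> /existsP [p /andP [up /eqP pv]]; exists p; rewrite size_tuple.
Qed.

Lemma dist_triangle v u w : dist u w <= dist u v + dist v w.
Proof.
have [p [up pv <-]] := dist_path u v; have [q [vq qw <-]] := dist_path v w.
rewrite -size_cat -qw -pv -last_cat; apply: dist_leq_size.
by rewrite cat_path up pv.
Qed.

Lemma dist_sym u v : dist u v = dist v u.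
Proof.
wlog suff : u v / dist u v <= dist v u.
  by move=> le_dist; apply/eqP; rewrite eqn_leq !le_dist.
have [p [vp pu <-]] := dist_path v u.
have := @dist_leq_size u (rev (belast v p)); rewrite size_rev size_belast.
have -> : last u (rev (belast v p)) = v.
  by case: p vp pu => [_ /= -> //|y p _ _]; rewrite /= rev_cons last_rcons.
apply; rewrite -pu rev_path; apply: sub_path vp => a b /=.
by rewrite adj_sym.
Qed.

Lemma dist_eq0 u v : dist u v = 0 -> u = v.
Proof.
by have [p [_ <- <-]] := dist_path u v => /size0nil ->.
Qed.

(** The predecessor of [u] towards [w]: the second vertex of a shortest walk from [u] to [w]. *)
Lemma dist_pred w u k :
  dist w u = k.+1 -> exists2 z, adj u z & dist w z = k.
Proof.
rewrite dist_sym => uwk; have [p [up pw]] := dist_path u w; rewrite uwk.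
case: p up pw => //= z p /andP [uz zp] pw [pk]; exists z => //.
apply/eqP; rewrite eqn_leq; apply/andP; split.
  by rewrite dist_sym -pw -pk dist_leq_size.
have := dist_triangle z u w; have := adj_dist_leq1 uz.
by rewrite (dist_sym z w); lia.
Qed.

Lemma dist_eq1 u v : dist u v = 1 -> adj u v.
Proof. by rewrite dist_sym => /dist_pred [z uz /dist_eq0 ->]. Qed.

Lemma adj_distL u v w : adj u v -> dist w u <= (dist w v).+1.
Proof.
move=> /adj_dist_leq1; have := dist_triangle v w u; rewrite (dist_sym v u); lia.
Qed.

(** Successive predecessors towards [w] are strictly closer to [w] than [u] is, so the walk never
    meets [u]. *)
Lemma connect_avoiding u w z :
  z != u -> dist w z <= dist w u -> connect (avoiding u) z w.
Proof.
have [k] := ubnP (dist w z); elim: k => // k IHk in z *.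
case zE: (dist w z) => [|j] jk zu ju; first by rewrite (dist_eq0 zE) connect0.
have [y zy yj] := dist_pred zE.
have yu : y != u by apply: contraTneq ju => <-; rewrite yj ltnn.
apply: connect_trans (IHk y _ yu _); rewrite ?yj // 1?ltnW //.
by apply: connect1; apply/and3P.
Qed.

(** * Predecessors and geodesics in clique trees *)

Hypothesis ctG : clique_tree G.

(** Both [z] and [v] are neighbours of [u], and they are joined through [w] without meeting [u]. *)
Lemma pred_adj w u v z k :
    adj u v -> adj u z -> dist w u = k.+1 -> dist w v = k.+1 -> dist w z = k ->
  adj z v.
Proof.
move=> uv uz wu wv wz.
have zv : z != v by apply: contra_eq_neq wv => <-; rewrite wz neq_ltn ltnSn.
apply: (clique_tree_neighbors ctG uz uv zv _).
have zu : z != u by apply: contra_eq_neq wu => <-; rewrite wz neq_ltn ltnSn.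
have vu : v != u by apply: contraTneq uv => ->; rewrite adj_irr.
apply: (@connect_trans _ _ w).
  by apply: connect_avoiding => //; rewrite wz wu.
by rewrite connect_avoiding_sym connect_avoiding // wv wu.
Qed.

Lemma adj_diamond u v y z :
  adj u y -> adj u z -> adj u v -> adj v y -> adj v z -> y != z -> adj y z.
Proof.
move=> uy uz uv vy vz yz; apply: (clique_tree_neighbors ctG uy uz yz _).
have neq a b : adj a b -> b != a by apply: contraTneq => ->; rewrite adj_irr.
apply: (@connect_trans _ _ v); apply: connect1; apply/and3P; split;
  by rewrite ?neq // adj_sym.
Qed.

(** Distinct predecessors would be adjacent, and a predecessor [y] of one would be adjacent to the
    other by [pred_adj]. The diamond then makes [y] adjacent to [u], although [y] is two steps
    closer to [w]. *)
Lemma pred_unique w u z z' k :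
    adj u z -> adj u z' -> dist w u = k.+1 -> dist w z = k -> dist w z' = k ->
  z = z'.
Proof.
move=> uz uz' wu wz wz'; apply/eqP/negPn/negP => zz'.
have zu : z != u by apply: contra_eq_neq wu => <-; rewrite wz neq_ltn ltnSn.
have zu' : z' != u by apply: contra_eq_neq wu => <-; rewrite wz' neq_ltn ltnSn.
have zz'_adj : adj z z'.
  apply: (clique_tree_neighbors ctG uz uz' zz' _).
  apply: (@connect_trans _ _ w).
    by apply: connect_avoiding => //; rewrite wz wu.
  by rewrite connect_avoiding_sym connect_avoiding // wz' wu.
case: k => [|k] in wu wz wz'.
  by rewrite -(dist_eq0 wz) -(dist_eq0 wz') eqxx in zz'.
have [y zy wy] := dist_pred wz.
have yz' := pred_adj zz'_adj zy wz wz' wy.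
have uy : adj u y.
  apply: (@adj_diamond z z'); rewrite // 1?adj_sym //.
  by apply: contra_eq_neq wu => ->; rewrite wy neq_ltn; lia.
have := adj_distL w uy; lia.
Qed.

Lemma adj_dist_cases w u v : adj u v ->
  [\/ dist w v = (dist w u).+1, dist w v = dist w u | dist w u = (dist w v).+1].
Proof.
move=> uv; have := adj_distL w uv; rewrite adj_sym in uv.
have := adj_distL w uv; case: (ltngtP (dist w u) (dist w v)) => c ? ?.
- by apply: Or31; lia.
- by apply: Or33; lia.
- by apply: Or32.
Qed.

(** An edge leading away from [a] and towards [d] lies on a geodesic. The next vertex [c2] towards
    [d] is again farther from [a]: otherwise it would be adjacent to [c] or equal to it, too close
    for their distances to [d]. *)
Lemma dist_concat_edge a c c' d :
    adj c c' -> dist d c = (dist d c').+1 -> dist a c' = (dist a c).+1 ->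
  dist a d = (dist a c).+1 + dist d c'.
Proof.
have [k] := ubnP (dist d c'); elim: k => // k IHk in c c' *.
case dc': (dist d c') => [|j] jk cc' dc ac'.
  by rewrite (dist_eq0 dc') addn0.
have [c2 c'c2 dc2] := dist_pred dc'.
have ac2 : dist a c2 = (dist a c').+1.
  have [//|ac2|ac2] := adj_dist_cases a c'c2.
    have := adj_distL d (pred_adj c'c2 _ ac' (etrans ac2 ac') (erefl _)).
    by rewrite adj_sym dc dc2 => /(_ cc'); lia.
  have cc2 : c = c2.
    by apply: (@pred_unique a c' _ _ (dist a c)); rewrite // 1?adj_sym //; lia.
  by rewrite cc2 dc2 in dc; lia.
rewrite (IHk c' c2) ?dc2 //; lia.
Qed.

(** The predecessor [z] of [c] towards [a] is adjacent to [c'], and the edge from [z] to [c']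
    satisfies the hypotheses of [dist_concat_edge]. *)
Lemma dist_concat_triangle a c c' d :
    adj c c' -> dist d c = (dist d c').+1 -> dist a c' = dist a c ->
  dist a d = dist a c' + dist d c'.
Proof.
move=> cc' dc ac'.
case ac: (dist a c) => [|k] in ac' *.
  by move: dc; rewrite -(dist_eq0 ac) -(dist_eq0 ac'); lia.
have [z cz az] := dist_pred ac.
have zc' := pred_adj cc' cz ac ac' az.
have dz : dist d z = (dist d c').+1.
  have [dz|dz|dz] := adj_dist_cases d zc'.
  - by have := adj_distL d cz; lia.
  - have zc'E : z = c'.
      by apply: (@pred_unique d c _ _ (dist d c')); rewrite // dc.
    by rewrite zc'E ac' in az; lia.
  - exact: dz.
rewrite (dist_concat_edge zc' dz) ?az ?ac' //; lia.
Qed.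

(** Induction on [dist c d], moving [c] to its predecessor [c'] towards [d]. *)
Lemma four_point a b c d :
  dist a b + dist c d <= maxn (dist a c + dist b d) (dist a d + dist b c).
Proof.
have [k] := ubnP (dist c d); elim: k => // k IHk in a b c *.
case cdE: (dist c d) => [|j] jk.
  by rewrite -(dist_eq0 cdE) addn0 maxnn [dist b c]dist_sym dist_triangle.
move: cdE; rewrite dist_sym => dc.
have [c' cc' dc'] := dist_pred dc.
(* Exchanging [a] and [b] swaps the two alternatives of the induction hypothesis, so one of them
   suffices. *)
suff key x y : dist x y + j <= dist x c' + dist y d ->
    dist x y + j.+1 <= maxn (dist x c + dist y d) (dist x d + dist y c).
  have := IHk a b c'; rewrite (dist_sym c' d) dc' => /(_ jk); rewrite leq_max.
  move=> /orP [le|le]; first exact: key.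
  rewrite maxnC addnC [dist a d + _]addnC [dist a c + _]addnC addnC dist_sym.
  by apply: key; rewrite dist_sym addnC [dist b c' + _]addnC addnC.
move=> le; have tri := dist_triangle c x y.
rewrite (dist_sym c y) in tri.
(* A failure leaves only the case where [c c'] is equidistant from both [x] and
   [y], with [c] on a geodesic between them.  The predecessors of [c] towards
   [x] and [y] are then distinct common neighbours of [c] and [c'], hence
   adjacent, which would shorten that geodesic. *)
have [xc'|xc'|xc'] := adj_dist_cases x cc'.
- have := dist_concat_edge cc' (etrans dc (congr1 _ (esym dc'))) xc'; lia.
- have xd := dist_concat_triangle cc' (etrans dc (congr1 _ (esym dc'))) xc'.
  rewrite leqNgt; apply/negP; rewrite gtn_max => /andP [lt1 lt2].
  have xcy : dist x y = dist x c + dist y c by lia.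
  have yd : dist y d + 1 = dist y c + j.+1 by lia.
  have [yc'|yc'|yc'] := adj_dist_cases y cc'.
  + have := dist_concat_edge cc' (etrans dc (congr1 _ (esym dc'))) yc'; lia.
  + case xc: (dist x c) => [|n] in xc' xcy *.
      by move: dc; rewrite -(dist_eq0 xc) (dist_eq0 xc') dc'; lia.
    case yc: (dist y c) => [|m] in yc' yd xcy *.
      by move: dc yd; rewrite -(dist_eq0 yc) (dist_sym d); lia.
    have [z cz xz] := dist_pred xc; have [t ct yt] := dist_pred yc.
    have zc' := pred_adj cc' cz xc xc' xz.
    have tc' := pred_adj cc' ct yc yc' yt.
    have xt : dist x t >= n.+2.
      by have := dist_triangle t x y; rewrite (dist_sym t y); lia.
    have zt : adj z t.
      apply: (@adj_diamond c c'); rewrite // 1?adj_sym //.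
      by apply: contraTneq xt => <-; rewrite xz; lia.
    by rewrite adj_sym in zt; have := adj_distL x zt; lia.
  + have := dist_triangle c' y d; rewrite (dist_sym c' d); lia.
- have := dist_triangle c x y; lia.
Qed.
End Distances.

(** * Eccentricities *)

(** The entries of [ecc_matrix] as natural numbers indexed by vertices. *)
Definition ecc_weight (G : sgraph) (u v : G) : nat :=
  if dist u v == minn (ecc u) (ecc v) then dist u v else 0.

Section Eccentricity.
Variable G : sgraph.
Implicit Types (c u v w x y z : G).

Lemma dist_leq_ecc u v : dist u v <= ecc u.
Proof. exact: leq_bigmax. Qed.

Lemma ecc_leq u n : (forall v, dist u v <= n) -> ecc u <= n.
Proof. by move=> un; apply/bigmax_leqP => v _. Qed.

Lemma ecc_leq_diam u : ecc u <= diam G.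
Proof. exact: leq_bigmax. Qed.

Lemma dist_leq_diam u v : dist u v <= diam G.
Proof. exact: leq_trans (dist_leq_ecc u v) (ecc_leq_diam u). Qed.

Hypothesis connG : graph_connected G.
Hypothesis ctG : clique_tree G.
Hypothesis G_gt1 : 1 < #|G|.

Let dist_sym := dist_sym connG.
Let dist_triangle := dist_triangle connG.
Let four_point := four_point connG ctG.

Lemma exists_diametral : exists x y, dist x y = diam G.
Proof.
have G_gt0 := ltnW G_gt1.
have [x xE] := eq_bigmax (@ecc G) G_gt0.
have [y yE] := eq_bigmax (dist x) G_gt0.
by exists x, y; rewrite /diam xE /ecc yE.
Qed.

Lemma diam_gt0 : 0 < diam G.
Proof.
have [x [y [_ _ xy]]] := card_gt1P G_gt1.
apply: leq_trans (dist_leq_diam x y); rewrite lt0n.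
by apply: contraNneq xy => /(dist_eq0 connG) ->.
Qed.

Lemma dist_split x y n :
  n <= dist x y -> exists2 c, dist x c = n & dist y c = dist x y - n.
Proof.
move=> /subnKC/esym; move: (dist x y - n) => k.
elim: k => [|k IHk] in y *.
  by rewrite addn0 => xy; exists y; rewrite // distxx.
rewrite addnS => xy; have [z yz xz] := dist_pred connG xy.
have [c xc zc] := IHk z xz; exists c => //.
have := adj_distL connG c yz; have := dist_triangle c x y.
by rewrite (dist_sym c y) (dist_sym c z); lia.
Qed.

(** In the four-point condition for [w], [v], [x], [y], the distances from [v] are at most
    [dist x y] and cancel against it. *)
Lemma ecc_diametral x y w :
  dist x y = diam G -> ecc w = maxn (dist x w) (dist y w).
Proof.
move=> xy; apply/eqP; rewrite eqn_leq geq_max; apply/and3P; split.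
- apply: ecc_leq => v; have := four_point w v x y.
  have := dist_leq_diam v x; have := dist_leq_diam v y.
  rewrite (dist_sym w x) (dist_sym w y); lia.
- by rewrite dist_sym dist_leq_ecc.
- by rewrite dist_sym dist_leq_ecc.
Qed.

Lemma ecc_weight_far u v : dist u v = ecc u -> ecc_weight u v = dist u v.
Proof.
move=> uv; rewrite /ecc_weight uv (minn_idPl _) ?eqxx //.
by rewrite -uv dist_sym dist_leq_ecc.
Qed.

Lemma ecc_weight_sym u v : ecc_weight u v = ecc_weight v u.
Proof. by rewrite /ecc_weight dist_sym minnC. Qed.

(** * The middle edge and the center in odd diameter *)

Section OddDiameter.
Variables (x y : G) (r : nat).
Hypothesis xy : dist x y = diam G.
Hypothesis diamE : diam G = r.*2.+1.

Lemma exists_middle_edge : exists u v,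
  [/\ adj u v, dist x u = r /\ dist y u = r.+1
    & dist x v = r.+1 /\ dist y v = r].
Proof.
have [|u xu yu] := @dist_split x y r; first lia.
have [|v uv yv] := @dist_split u y 1; first by rewrite dist_sym; lia.
rewrite (dist_sym u) in yv.
have := dist_triangle u x v; have := dist_triangle v x y.
rewrite (dist_sym v y) => ? ?.
by exists u, v; split; first exact: (dist_eq1 connG); lia.
Qed.

(** The radius is [r.+1]: the end [u] of the middle edge attains it, and any vertex is at least that
    far from [x] or [y], whose distance is [r.*2.+1]. *)
Lemma mem_center_odd w : (w \in center G) = (ecc w <= r.+1).
Proof.
have eccE := ecc_diametral _ xy.
have [u [_ [_ [xu yu] _]]] := exists_middle_edge.
rewrite inE; apply/forallP/idP => [/(_ u)|le_w v].
  by rewrite (eccE u) xu yu; lia.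
apply: leq_trans le_w _; rewrite eccE; have := dist_triangle v x y.
rewrite (dist_sym v y); lia.
Qed.

Lemma middle_unique u w :
  dist x u + dist y w <= diam G -> dist x w + dist y u <= diam G -> u = w.
Proof.
move=> le1 le2; apply: (dist_eq0 connG); have := four_point u w x y.
by rewrite (dist_sym u x) (dist_sym u y) (dist_sym w x) (dist_sym w y); lia.
Qed.
End OddDiameter.

(** * Triangles and bipartition in the eccentricity matrix *)

Lemma no_weight_triangle :
    (forall x y z : G,
       ecc_weight x y * ecc_weight y z * ecc_weight z x = 0) ->
  odd (diam G) /\ exists u v : G, adj u v /\ center G = [set u; v].
Proof.
move=> noT; have [x [y xy]] := exists_diametral; have D0 := diam_gt0.
have eccE w := ecc_diametral w xy.
(* The triangle [x], [y], [w] has weights [diam G], [ecc w] and [ecc w]. *)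
have no_equidistant w : dist x w = ecc w -> dist y w = ecc w -> dist x w = 0.
  move=> xw yw; have := noT x y w.
  rewrite (ecc_weight_sym y) (@ecc_weight_far x y); last first.
    by rewrite eccE distxx; have := dist_sym x y; lia.
  rewrite !(@ecc_weight_far w) ?(dist_sym w) //; lia.
have [Dodd|Deven] := boolP (odd (diam G)); last first.
  have [|c xc yc] := @dist_split x y (diam G)./2; first by lia.
  by have := no_equidistant c; rewrite eccE; lia.
split=> //; have DE : diam G = (diam G)./2.*2.+1 by lia.
have [u [v [uv [xu yu] [xv yv]]]] := exists_middle_edge xy DE.
exists u, v; split=> //; apply/setP => w.
rewrite (mem_center_odd xy DE) in_set2; apply/idP/orP.
  (* The distances from [w] to [x] and [y] are at most [(diam G)./2.+1] and cannot both equal it, so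
     one is [(diam G)./2]. *)
  move=> le_w; have := no_equidistant w.
  have := dist_triangle w x y; rewrite (dist_sym w y) in le_w *.
  rewrite !eccE in le_w *; move=> tri neq.
  have [xw|xw] : dist x w = (diam G)./2 \/ dist y w = (diam G)./2 by lia.
    by left; apply/eqP; apply: (middle_unique xy DE); lia.
  by right; apply/eqP; apply: (middle_unique xy DE); lia.
by move=> [] /eqP ->; rewrite eccE; lia.
Qed.

Lemma ecc_weight_same_side u v y w z r :
    adj u v -> dist y u = r.+1 -> dist y v = r -> ecc v <= r.+1 ->
    dist w v = (dist w u).+1 -> dist z v = (dist z u).+1 ->
  ecc_weight w z = 0.
Proof.
move=> uv yu yv ev; move: w z.
(* By the four-point condition for [w], [v], [u], [y], a geodesic from [w] to [y] is at least as
   long as the route through the edge [uv]. *)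
have far w : dist w v = (dist w u).+1 -> dist w u <= r /\ dist w u + r < ecc w.
  move=> wv; have := dist_leq_ecc v w; have := dist_leq_ecc w y.
  have := four_point w v u y; have := adj_dist_leq1 uv.
  rewrite (dist_sym v w) (dist_sym v u) (dist_sym u y) (dist_sym v y); lia.
move=> w z /far [wu ew] /far [zu ez]; rewrite /ecc_weight; case: eqP => //.
by have := dist_triangle u w z; rewrite (dist_sym u z); lia.
Qed.

Lemma ecc_weight_bipartite :
    odd (diam G) -> (exists u v : G, adj u v /\ center G = [set u; v]) ->
  exists side : pred G, forall w z, side w = side z -> ecc_weight w z = 0.
Proof.
move=> Dodd [u0 [v0 [_ C0]]]; have [x [y xy]] := exists_diametral.
have eccE w := ecc_diametral w xy.
have DE : diam G = (diam G)./2.*2.+1 by lia.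
have [u [v [uv [xu yu] [xv yv]]]] := exists_middle_edge xy DE.
set r := (diam G)./2 in DE xu yu xv yv.
have centerE := mem_center_odd xy DE.
have uNv : u != v by apply: contraTneq uv => ->; rewrite adj_irr.
(* Both ends of the middle edge are central, and the center has at most two elements. *)
have C : center G = [set u; v].
  apply/esym/eqP; rewrite eqEcard C0 !cards2 uNv ltnS leq_b1 andbT -C0.
  by apply/subsetP => w /set2P [] ->; rewrite centerE eccE; lia.
(* The predecessor of [u] towards an equidistant [w] would be adjacent to [u] and [v], hence a third
   central vertex. *)
have sides w : dist w u != dist w v.
  apply: contraNneq uNv; case wu: (dist w u) => [|k] wv.
    by rewrite -(dist_eq0 connG wu) (dist_eq0 connG (esym wv)).
  have [z uz wz] := dist_pred connG wu.
  have zv := pred_adj connG ctG uv uz wu (esym wv) wz.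
  have : z \in center G.
    rewrite centerE eccE; rewrite adj_sym in uz.
    by have := adj_distL connG x uz; have := adj_distL connG y zv; lia.
  by rewrite C => /set2P [] zE; rewrite zE in wz; lia.
exists (fun w => dist w u < dist w v) => w z.
have vu : adj v u by rewrite adj_sym.
have := adj_distL connG w uv; have := adj_distL connG w vu.
have := adj_distL connG z uv; have := adj_distL connG z vu.
have := sides w; have := sides z => ? ? ? ? ? ?.
case: ltnP => [lt_w|le_w] /esym z_side.
  by apply: (ecc_weight_same_side uv yu yv); rewrite ?eccE; lia.
(* The other side follows by reversing the edge and letting [x] play the part of [y]. *)
by apply: (ecc_weight_same_side vu xv xu); rewrite ?eccE; lia.
Qed.
End Eccentricity.

Theorem theorem4p5 (R : realType) (G : sgraph) (G_gt1 : 1 < #|G|)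
    (G_CT : in_CT G) :
  spectrum_symmetric (ecc_matrix R G) <->
  odd (diam G) /\ exists u v : G, adj u v /\ center G = [set u; v].
Proof.
have [[connG blockG] _] := G_CT; have ctG : clique_tree G by [].
have matE i j :
  ecc_matrix R G i j = ((ecc_weight (enum_val i) (enum_val j))%:R)%R.
  by rewrite mxE /ecc_weight; case: ifP.
split=> [symm|[Dodd center2]].
  apply: no_weight_triangle => // x y z.
  have symA : ((ecc_matrix R G)^T = ecc_matrix R G)%R.
    by apply/matrixP => i j; rewrite mxE !matE ecc_weight_sym.
  have := symmetric_spectrum_trace_cube symA symm.
  move/trace_cube_eq0 => /(_ _ (enum_rank x) (enum_rank y) (enum_rank z)).
  rewrite !matE !enum_rankK -!natrM => /(_ _)/eqP; rewrite pnatr_eq0 => tri.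
  by apply/eqP/tri => i j; rewrite matE ler0n.
have [side sideP] := ecc_weight_bipartite connG ctG G_gt1 Dodd center2.
apply: (@bipartite_spectrum_symmetric _ _ _ (fun i => side (enum_val i))).
by move=> i j /sideP ij; rewrite matE ij.
Qed.
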